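(* Let $f:(0,1]\to[0,\infty)$ be non-increasing. Every instance of utility configuration with excludable actions that is locally $f(q)$-utility aligned is also $\max\left(4f(q),\,4/\sqrt{q}\right)$-utility aligned.
   Context: **Utility configuration.** An instance consists of $n$ actions; each action $i$ has a set of possible configurations, and configuration $j$ of action $i$ induces a joint distribution $F_{ij}$ over pairs $(u_i^A,u_i^P)$ of agent and principal utilities, with $u_i^A\in\mathbb{R}\cup\{-\infty\}$ and $u_i^P\ge 0$. A solution (a configuration) is a choice $\mathbf{C}=(C_1,\dots,C_n)$ of one configuration per action. Given $\mathbf{C}$, the pairs $(u_i^A,u_i^P)\sim F_{iC_i}$ are drawn independently across actions $i$, and the agent picks $i^*(\mathbf{C})\in\arg\max_i u_i^A$, ties being broken in favor of the principal. Write $u^A=u^A_{i^*(\mathbf{C})}$ and $u^P=u^P_{i^*(\mathbf{C})}$. The principal's objective is $\mathbb{E}[u^P]$; an optimal configuration maximizes it. **Utility alignment.** For a non-increasing function $g$ on $(0,1]$, an instance is $g(q)$-utility aligned if for every optimal configuration $\mathbf{C}^*$ and every threshold $U$ with $q=\Pr[u^A\le U]>0$ under $\mathbf{C}^*$, one has $\mathbb{E}[u^P\mid u^A\le U]\le g(q)\,\mathbb{E}[u^P]$ under $\mathbf{C}^*$. **Local utility alignment.** For a non-increasing function $f$ on $(0,1]$, an instance is locally $f(q)$-utility aligned if for every action $i$, every configuration $j$ of $i$ and every utility level $U$ with $q=\Pr_{F_{ij}}[u_i^A\le U]>0$, one has $\mathbb{E}_{(u_i^A,u_i^P)\sim F_{ij}}[u_i^P\mid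 u_i^A\le U]\le f(q)\,\mathbb{E}_{(u_i^A,u_i^P)\sim F_{ij}}[u_i^P]$. **Excludable actions.** An instance has excludable actions if every action $i$ has a configuration in which $u_i^A=-\infty$ deterministically. *)

(* Defs.v *)
(* MathComp world (MathComp-Analysis). *)
From HB Require Import structures.
From mathcomp Require Import all_boot all_order all_algebra.
From mathcomp Require Import all_classical all_reals all_analysis measurable_realfun.

Set Implicit Arguments.
Unset Strict Implicit.
Unset Printing Implicit Defensive.

Import Order.TTheory GRing.Theory Num.Theory.

Local Open Scope classical_set_scope.
Local Open Scope ring_scope.

Section product_law.
Context d (T : measurableType d) (R : realType).

Definition tuple_cons n (p : T * n.-tuple T) : n.+1.-tuple T :=
  [tuple of p.1 :: p.2].

Lemma measurable_tuple_cons n : measurable_fun [set: T * n.-tuple T] (@tuple_cons n).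
Proof. exact: measurable_cons. Qed.

HB.instance Definition _ n :=
  isMeasurableFun.Build _ _ _ _ (@tuple_cons n) (@measurable_tuple_cons n).

(* The library has binary product measures only. [product_law P] is the law of
   independent draws from P_0, ..., P_(n-1); see [product_law_box]. *)
Fixpoint product_law n : ('I_n -> probability T R) -> probability (n.-tuple T) R :=
  match n with
  | 0 => fun _ => \d_([tuple] : 0.-tuple T)
  | m.+1 => fun P =>
      distribution (P ord0 \x product_law (fun i => P (lift ord0 i)))%E
        (@tuple_cons m)
  end.

Lemma product_law_box n (P : 'I_n -> probability T R) (A : 'I_n -> set T) :
  (forall i, measurable (A i)) ->
  (product_law P [set t | forall i, A i (tnth t i)] = \prod_(i < n) P i (A i))%E.
Proof.
elim: n P A => [|n IH] P A mA.
  rewrite big_ord0 /= diracE mem_set//=.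
  by case.
rewrite big_ord_recl -IH // /= /distribution /pushforward.
rewrite (_ : _ @^-1` _ = A ord0 `*`
    [set t : n.-tuple T | forall i, A (lift ord0 i) (tnth t i)]); last first.
  apply/seteqP; split => -[x t] /=.
    move=> h; split; first by have := h ord0; rewrite tnth0.
    by move=> i; have := h (lift ord0 i); rewrite tnthS.
  move=> [h0 hS] i; case: (unliftP ord0 i) => [j|] ->.
    by rewrite tnthS.
  by rewrite tnth0.
rewrite product_measure1E //.
rewrite (_ : [set t | _] =
    \bigcap_(i in [set: 'I_n]) ((@tnth n T ^~ i) @^-1` A (lift ord0 i))); last first.
  by apply/seteqP; split => t h i //=; exact: h.
apply: fin_bigcap_measurable; first exact: finite_finset.
by move=> i _; rewrite -[X in measurable X]setTI; apply: measurable_tnth.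
Qed.

End product_law.

Section conditional_expectation.
Context d (T : measurableType d) (R : realType).

(* E[X | A], meaningful for an event A of positive probability. *)
Definition cond_expectation (P : probability T R) (X : T -> R) (A : set T) : \bar R :=
  ((\int[P]_(x in A) (X x)%:E) * ((fine (P A))^-1)%:E)%E.

End conditional_expectation.

(* Pairs (u^A, u^P) of agent and principal utilities, with the Borel
   sigma-algebra; [lawP] restricts the values to (R U {-oo}) x [0, +oo[. *)
Notation utility_pair R := (\bar R * R)%type.

Record instance (R : realType) (n : nat) := Instance {
  config : 'I_n -> Type ;
  law : forall i, config i -> probability (utility_pair R) R ;
  lawP : forall i (j : config i),
    {ae law j, forall u, u.1 != +oo%E /\ 0 <= u.2} }.

Section utility_configuration.
Context (R : realType) (n : nat) (I : instance R n.+1).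

Definition solution := forall i, config I i.

Definition joint_law (C : solution) : probability (n.+1.-tuple (utility_pair R)) R :=
  product_law (fun i => law (C i)).

(* The action i^* picked at the realized utilities w: among the maximizers of
   u^A, one with the largest u^P. Remaining ties do not affect (u^A, u^P). *)
Definition chosen (w : n.+1.-tuple (utility_pair R)) : 'I_n.+1 :=
  let i0 := [arg max_(i > ord0) (tnth w i).1]%O in
  [arg max_(i > i0 | (tnth w i).1 == (tnth w i0).1) (tnth w i).2]%O.

Definition uA (w : n.+1.-tuple (utility_pair R)) : \bar R := (tnth w (chosen w)).1.

Definition uP (w : n.+1.-tuple (utility_pair R)) : R := (tnth w (chosen w)).2.

Lemma chosenP (w : n.+1.-tuple (utility_pair R)) (k : 'I_n.+1) :
  ((tnth w k).1 <= uA w)%E /\ ((tnth w k).1 = uA w -> (tnth w k).2 <= uP w).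
Proof.
rewrite /uA /uP /chosen.
case: (@arg_maxP _ _ _ ord0 xpredT (fun i => (tnth w i).1)) => //= i0 _ max_i0.
case: (@arg_maxP _ _ _ i0) => [|i /eqP -> max_i]; first exact: eqxx.
by split=> [|kE]; [exact: max_i0 | apply: max_i; rewrite kE].
Qed.

(* Expectations of principal utilities are extended reals: they may be +oo. *)
Definition objective (C : solution) : \bar R := ('E_(joint_law C)[uP])%E.

Definition optimal (C : solution) : Prop :=
  forall C' : solution, (objective C' <= objective C)%E.

Definition nonincreasing01 (g : R -> R) : Prop :=
  forall x y, 0 < x -> x <= y -> y <= 1 -> g y <= g x.

(* Thresholds U range over the values R U {-oo} of agent utilities, and g is
   only ever evaluated on ]0, 1]. *)
Definition utility_aligned (g : R -> R) : Prop :=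
  nonincreasing01 g /\
  forall (C : solution) (U : \bar R), optimal C -> U != +oo%E ->
    let P := joint_law C in
    let A := [set w | (uA w <= U)%E] in
    let q := fine (P A) in
    0 < q -> (cond_expectation P uP A <= (g q)%:E * objective C)%E.

Definition locally_utility_aligned (f : R -> R) : Prop :=
  nonincreasing01 f /\
  forall i (j : config I i) (U : \bar R), U != +oo%E ->
    let P := law j in
    let A := [set u : utility_pair R | (u.1 <= U)%E] in
    let uPi := fun u : utility_pair R => u.2 in
    let q := fine (P A) in
    0 < q -> (cond_expectation P uPi A <= (f q)%:E * 'E_P[uPi])%E.

Definition excludable : Prop :=
  forall i, exists j : config I i, {ae law j, forall u, u.1 = -oo%E}.

End utility_configuration.

(* Main.v *)
(* Let p_i be the probability that action i yields the agent at most U, so that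
   q is the product of the p_i. Choose k such that the actions before k and
   those after k both have a product of p_i at least sqrt q. Given u^A <= U,
   the principal gets at most the sum of what he gets from the three groups
   i < k, i = k and i > k. Excluding all actions outside one of the outer
   groups is a solution worth at most the optimum, and conditioning it on an
   event of probability at least sqrt q costs a factor at most 1 / sqrt q.
   Keeping only k gives E[u_k^P] <= OPT, so local alignment bounds the middle
   group by f(p_k) OPT <= f(q) OPT. *)
Require Import Defs.
From mathcomp Require Import all_boot all_order all_algebra.
From mathcomp Require Import all_classical all_reals all_analysis measurable_realfun.
From mathcomp Require Import ring lra.

Set Implicit Arguments.
Unset Strict Implicit.
Unset Printing Implicit Defensive.

Import Order.TTheory GRing.Theory Num.Theory.
Local Open Scope ring_scope.

(** * Integration against a law of independent draws *)

Section product_law_integral.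
Local Open Scope classical_set_scope.
Local Open Scope ereal_scope.
Context d (T : measurableType d) (R : realType).

Lemma measurable_box n (S : pred 'I_n) (B : 'I_n -> set T) :
  (forall i, measurable (B i)) ->
  measurable [set w : n.-tuple T | forall i, S i -> B i (tnth w i)].
Proof.
move=> mB; rewrite (_ : [set _ | _] =
    \bigcap_(i in [set i | S i]) ((@tnth n T ^~ i) @^-1` B i)); last first.
  by apply/seteqP; split => w h i Si; exact: h.
apply: fin_bigcap_measurable; first exact: finite_finset.
by move=> i _; rewrite -[X in measurable X]setTI; apply: measurable_tnth.
Qed.

(** This is independence: constraints on the coordinates outside [S] factor out of an integrand that
    only reads coordinates in [S]. The laws outside [S] then no longer matter to the remaining
    integral, so it may be taken under [P']; below, [P'] comes from a solution that excludes the
    actions outside [S]. The proof peels off the head coordinate with Tonelli. *)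
Lemma integral_product_law_box n (P P' : 'I_n -> probability T R)
    (S : pred 'I_n) (B : 'I_n -> set T) (h : n.-tuple T -> \bar R) :
  (forall i, measurable (B i)) ->
  (forall i, S i -> P i = P' i) ->
  measurable_fun [set: n.-tuple T] h -> (forall w, 0 <= h w) ->
  (forall w w', (forall i, S i -> tnth w i = tnth w' i) -> h w = h w') ->
  \int[product_law P]_(w in [set w | forall i, ~~ S i -> B i (tnth w i)]) h w =
  (\prod_(i < n | ~~ S i) P i (B i)) * \int[product_law P']_w h w.
Proof.
elim: n P P' S B h => [|n IH] P P' S B h mB PP' mh h0 hS.
  rewrite big_ord0 mul1e (_ : [set _ | _] = setT) //.
  by apply/seteqP; split => // w _ [].
have mD := @measurable_box _ (fun i => ~~ S i) B mB.
set D := [set w | _] in mD *.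
pose P1 i := P (lift ord0 i); pose P1' i := P' (lift ord0 i).
pose S1 : pred 'I_n := fun i => S (lift ord0 i).
pose B1 i := B (lift ord0 i).
pose D1 := [set w : n.-tuple T | forall i, ~~ S1 i -> B1 i (tnth w i)].
pose c := \prod_(i < n | ~~ S1 i) P1 i (B1 i).
have c0 : 0 <= c by apply: prode_ge0 => i _; exact: measure_ge0.
have mcons := @measurable_tuple_cons _ T n.
have mhc : measurable_fun setT (h \o @tuple_cons _ T n) by exact: measurableT_comp.
pose J x := \int[product_law P1']_t h (tuple_cons (x, t)).
have inner x : \int[product_law P1]_(t in D1) h (tuple_cons (x, t)) = c * J x.
  apply: (IH P1 P1' S1 B1 (fun t => h (tuple_cons (x, t)))) => //.
  - by move=> i; exact: mB.
  - by move=> i Si; apply: PP'.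
  - exact: (measurableT_comp mhc (measurable_pair1 x)).
  - move=> w w' ww'; apply: hS => i; case: (unliftP ord0 i) => [j|] -> Sj.
      by rewrite !tnthS; apply: ww'.
    by rewrite !tnth0.
have hE : \int[product_law P']_w h w = \int[P' ord0]_x J x.
  rewrite /= ge0_integral_distribution //.
  by rewrite fubini_tonelli1 // => x; exact: h0.
have mJ : measurable_fun setT J.
  by apply: (measurable_fun_fubini_tonelli_F (h \o @tuple_cons _ T n)) => // x; exact: h0.
have J0 x : 0 <= J x by exact: integral_ge0.
rewrite hE big_mkcond big_ord_recl -big_mkcond /= -/c.
have hD0 w : 0 <= (h \_ D) w by rewrite /patch; case: ifP.
have mhD : measurable_fun setT (h \_ D).
  by apply/(measurable_restrict _ mD) => //; rewrite setTI; exact: measurable_funTS.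
rewrite integral_mkcond /= ge0_integral_distribution // fubini_tonelli1 /=; last 2 first.
- exact: measurableT_comp.
- by move=> x; exact: hD0.
have DE x t : ~~ S ord0 -> (tuple_cons (x, t) \in D) = (x \in B ord0) && (t \in D1).
  move=> S0; apply/idP/andP; rewrite !inE.
    move=> Dxt; split; first by have := Dxt _ S0; rewrite tnth0.
    by move=> i Si; have := Dxt _ Si; rewrite tnthS.
  move=> [B0 Dt] i; case: (unliftP ord0 i) => [j|] -> Sj.
    by rewrite tnthS; apply: Dt.
  by rewrite tnth0.
have DE' x t : S ord0 -> (tuple_cons (x, t) \in D) = (t \in D1).
  move=> S0; apply/idP/idP; rewrite !inE.
    by move=> Dxt i Si; have := Dxt _ Si; rewrite tnthS.
  move=> Dt i; case: (unliftP ord0 i) => [j|] -> Sj.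
    by rewrite tnthS; apply: Dt.
  by rewrite S0 in Sj.
(* If the head lies outside [S], [h] ignores it, so [J] is constant, with value read at some [x0] (a
   probability space is nonempty), and the head contributes the factor [P ord0 (B ord0)]. Otherwise
   the head is unconstrained and has the same law under [P] and [P']. *)
case: ifPn => [S0|/negPn S0].
  have [x0 _] : [set: T] !=set0.
    apply/set0P/eqP => T0; have := probability_setT (P ord0).
    by rewrite T0 measure0 => /eqP; rewrite eq_sym onee_eq0.
  have Jcst x : J x = J x0.
    apply: eq_integral => t _; apply: hS => i; case: (unliftP ord0 i) => [j|] -> Sj.
      by rewrite !tnthS.
    by rewrite Sj in S0.
  rewrite (eq_integral (cst (c * J x0) \_ (B ord0))); last first.
    move=> x _; rewrite /fubini_F /= patchE; case: ifPn => xB.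
      rewrite -(Jcst x) -inner [RHS]integral_mkcond; apply: eq_integral => t _.
      by rewrite /= !patchE DE // xB.
    by rewrite integral0_eq // => t _; rewrite /= patchE DE // (negbTE xB).
  rewrite -integral_mkcond integral_cst // (eq_integral (cst (J x0))).
    rewrite integral_cst //; transitivity (c * J x0 * P ord0 (B ord0)) => //.
    rewrite muleC muleA -[in LHS](mule1 (J x0)).
    by congr (_ * (_ * _)); exact/esym/probability_setT.
  by move=> x _; rewrite Jcst.
rewrite mul1e (PP' _ S0) -ge0_integralZl //; apply: eq_integral => x _.
rewrite -inner [RHS]integral_mkcond; apply: eq_integral => t _.
by rewrite /= !patchE DE'.
Qed.

Lemma product_law_tnth n (P : 'I_n -> probability T R) (k : 'I_n) (A : set T) :
  measurable A -> product_law P ((@tnth n T ^~ k) @^-1` A) = P k A.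
Proof.
move=> mA; pose B i := if i == k then A else setT.
have mB i : measurable (B i) by rewrite /B; case: ifP.
have := product_law_box P mB; rewrite (bigD1 k) //= {2}/B eqxx big1 ?mule1.
  move=> <-; congr (product_law P _); apply/seteqP; split => w /=.
    by move=> Aw i; rewrite /B; case: eqP => [->|].
  by move=> /(_ k); rewrite /B eqxx.
by move=> i ik; rewrite /B (negbTE ik) probability_setT.
Qed.

Lemma integral_product_law_tnth n (P : 'I_n -> probability T R) (k : 'I_n)
    (f : T -> \bar R) :
  measurable_fun setT f -> (forall x, 0 <= f x) ->
  \int[product_law P]_w f (tnth w k) = \int[P k]_x f x.
Proof.
move=> mf f0.
rewrite -[LHS](ge0_integral_pushforward (measurable_tnth k) (product_law P) measurableT) //.
by apply: eq_measure_integral => [|mk A mA _]; [exact: measurable_tnth|exact: product_law_tnth].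
Qed.

(** Each of the finitely many properties can fail only on a cylinder over a null set, which is
    itself null. *)
Lemma ae_product_law n (P : 'I_n -> probability T R) (Q : 'I_n -> T -> Prop) :
  (forall i, {ae P i, forall x, Q i x}) ->
  {ae product_law P, forall w, forall i, Q i (tnth w i)}.
Proof.
move=> PQ; apply: filter_forall => i.
have [N [mN PN0 QN]] := PQ i.
exists ((@tnth n T ^~ i) @^-1` N); split.
- by rewrite -[X in measurable X]setTI; apply: measurable_tnth.
- by rewrite product_law_tnth.
- by move=> w /= Qw; apply: QN.
Qed.

End product_law_integral.

(** * The principal's payoff when actions are masked *)

Section chosen_utility.
Local Open Scope classical_set_scope.
Context (R : realType) (n : nat).
Implicit Types (w : n.+1.-tuple (utility_pair R)) (S : pred 'I_n.+1).

Lemma le_uP w i :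
  (forall j, (tnth w j).1 <= (tnth w i).1)%E -> (tnth w i).2 <= uP w.
Proof.
move=> wi; have [le_uA eq_uA] := chosenP w i.
by apply: eq_uA; apply/eqP; rewrite eq_le le_uA wi.
Qed.

Lemma uA_leE (U : \bar R) :
  [set w : n.+1.-tuple (utility_pair R) | (uA w <= U)%E] =
  [set w | forall i, ((tnth w i).1 <= U)%E].
Proof.
apply/seteqP; split => w /= wU; last exact: wU.
by move=> i; apply: le_trans wU; have [] := chosenP w i.
Qed.

(* Clamping at 0 makes this nonnegative everywhere: laws only give u^P >= 0
   almost surely. *)
Definition mask S w : n.+1.-tuple (utility_pair R) :=
  [tuple (if S i then ((tnth w i).1, Num.max 0 (tnth w i).2) else (-oo%E, 0))
  | i < n.+1].

Lemma mask_uP_ge0 S w : 0 <= uP (mask S w).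
Proof. by rewrite /uP tnth_mktuple; case: ifP => //= _; rewrite le_max lexx. Qed.

(** Masking only removes competitors of the chosen action, which thus remains a maximizer of [u^A],
    and clamping can only raise its [u^P]. *)
Lemma uP_le_mask S w : S (chosen w) -> uP w <= uP (mask S w).
Proof.
move=> Sw; apply: (@le_trans _ _ (tnth (mask S w) (chosen w)).2).
  by rewrite tnth_mktuple Sw /= le_max lexx orbT.
apply: le_uP => j; rewrite !tnth_mktuple Sw /=; case: ifP => _ /=; last exact: leNye.
by have [] := chosenP w j.
Qed.

(** The hypotheses describe the outcomes that occur almost surely once the actions outside [S] are
    excluded. On these, masking changes no [u^A] and can only lower [u^P], so the action chosen
    after masking is already a maximizer before it. *)
Lemma mask_le_uP S w : (forall i, 0 <= (tnth w i).2) ->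
  (forall i, ~~ S i -> (tnth w i).1 = -oo%E) -> uP (mask S w) <= uP w.
Proof.
move=> w0 wS.
have mask1 i : (tnth (mask S w) i).1 = (tnth w i).1.
  by rewrite tnth_mktuple; case: ifPn => //= /wS.
pose c := chosen (mask S w); apply: (@le_trans _ _ (tnth w c).2).
  by rewrite /uP -/c tnth_mktuple; case: ifP => //= _; rewrite ge_max w0 lexx.
by apply: le_uP => j; rewrite -!mask1; have [] := chosenP (mask S w) j.
Qed.

Lemma eq_mask S w w' :
  (forall i, S i -> tnth w i = tnth w' i) -> mask S w = mask S w'.
Proof.
move=> ww'; apply: eq_from_tnth => i; rewrite !tnth_mktuple.
by case: ifP => // /ww' ->.
Qed.

Lemma measurable_tnth1 i :
  measurable_fun setT (fun w => (tnth w i).1).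
Proof. exact: measurableT_comp measurable_fst (measurable_tnth i). Qed.

Lemma measurable_tnth2 i :
  measurable_fun setT (fun w => (tnth w i).2).
Proof. exact: measurableT_comp measurable_snd (measurable_tnth i). Qed.

Lemma measurable_uP : measurable_fun setT (@uP R n).
Proof.
apply: (measurability (@RGenCInfty.G R)) => [|/= _ [_] [r] -> <-].
  exact: RGenCInfty.measurableE.
(* Tie-breaking for the principal makes [r <= uP w] equivalent to the existence of a maximizer of
   [u^A] with [u^P] at least [r]. This describes the preimage by finitely many comparisons, without
   measurability of the arg max. *)
rewrite setTI (_ : _ @^-1` _ = \bigcup_(i in [set: 'I_n.+1])
  ((\bigcap_(j in [set: 'I_n.+1]) [set w | (tnth w j).1 <= (tnth w i).1]%E) `&`
   [set w | r <= (tnth w i).2])); last first.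
  apply/seteqP; split => w /=; rewrite in_itv /= andbT.
    move=> rw; exists (chosen w) => //; split => // j _ /=.
    by have [] := chosenP w j.
  by move=> [i _ [wi ri]]; apply: le_trans ri _; apply: le_uP => j; exact: wi.
apply: fin_bigcup_measurable; first exact: finite_finset.
move=> i _; apply: measurableI.
  apply: fin_bigcap_measurable; first exact: finite_finset.
  move=> j _; rewrite -[X in measurable X]setTI.
  by apply: measurable_lee => //; exact: measurable_tnth1.
rewrite -[X in measurable X]setTI; apply: measurable_fun_le => //.
exact: measurable_tnth2.
Qed.

Lemma measurable_mask S : measurable_fun setT (mask S).
Proof.
apply/measurable_fun_tnthP => i.
rewrite (_ : _ \o _ = fun w =>
  if S i then ((tnth w i).1, Num.max 0 (tnth w i).2) else (-oo%E, 0)); last first.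
  by apply/funext => w /=; rewrite tnth_mktuple.
case: (S i); last exact: measurable_cst.
apply: measurable_fun_pair; first exact: measurable_tnth1.
by apply: measurable_maxr => //; exact: measurable_tnth2.
Qed.

Lemma measurable_mask_uP S : measurable_fun setT (fun w => (uP (mask S w))%:E).
Proof.
apply/measurable_EFinP.
exact: measurableT_comp measurable_uP (measurable_mask S).
Qed.

End chosen_utility.

Lemma measurable_utility_below (R : realType) (U : \bar R) :
  measurable [set u : utility_pair R | (u.1 <= U)%E]%classic.
Proof.
rewrite -[X in measurable X]setTI.
by apply: emeasurable_fun_infty_c => //; exact: measurable_fst.
Qed.

(** * Bounds obtained by excluding actions from an optimal solution *)

Section exclusion.
Local Open Scope classical_set_scope.
Local Open Scope ereal_scope.
Context (R : realType) (n : nat) (I : instance R n.+1).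

(** Clamping alters the payoff on a null set only, and gives the everywhere nonnegative integrand
    that monotonicity arguments use. *)
Lemma objectiveE (C : solution I) :
  objective C = \int[joint_law C]_w (Num.max 0%R (uP w))%:E.
Proof.
rewrite /objective unlock; apply: ae_eq_integral => //.
- by apply/measurable_EFinP; exact: measurable_uP.
- by apply/measurable_EFinP; apply: measurable_maxr => //; exact: measurable_uP.
- have := ae_product_law (fun i => lawP (C i)).
  apply: filterS => w w0 _; congr (_%:E).
  by rewrite max_r //; have [] := w0 (chosen w).
Qed.

Lemma objective_ge0 (C : solution I) : 0 <= objective C.
Proof. by rewrite objectiveE; apply: integral_ge0 => w _; rewrite lee_fin le_max lexx. Qed.

Lemma expectation_lawE i (j : config I i) :
  'E_(law j)[fun u : utility_pair R => u.2] =
  \int[law j]_u (Num.max 0%R u.2)%:E.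
Proof.
rewrite unlock; apply: ae_eq_integral => //.
- by apply/measurable_EFinP; exact: measurable_snd.
- by apply/measurable_EFinP; apply: measurable_maxr => //; exact: measurable_snd.
- by apply: filterS (lawP j) => u [_ u0] _; rewrite max_r.
Qed.

Definition exclude (e C : solution I) (S : pred 'I_n.+1) : solution I :=
  fun i => if S i then C i else e i.

Context (I_excl : excludable I).

Definition excluded : solution I := fun i => sval (cid (I_excl i)).

Lemma ae_exclude (C : solution I) (S : pred 'I_n.+1) :
  {ae joint_law (exclude excluded C S), forall w,
    forall i, (0 <= (tnth w i).2)%R /\ (~~ S i -> (tnth w i).1 = -oo)}.
Proof.
suff h i : {ae law (exclude excluded C S i), forall u,
    (0 <= u.2)%R /\ (~~ S i -> u.1 = -oo)} by exact: (ae_product_law h).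
apply: filterS2 (lawP (exclude excluded C S i)) (_ : {ae _, forall u, ~~ S i -> u.1 = -oo}).
  by move=> u [_ u0] uS; split.
rewrite /exclude; case: ifPn => Si; first by apply: filterE.
have := svalP (cid (I_excl i)); exact: filterS.
Qed.

Context (C : solution I) (C_opt : optimal C).

(** Under the solution that excludes the actions outside [S], the masked payoff is almost surely at
    most the true one, whose expectation is bounded by optimality of [C]. *)
Lemma mask_le_objective (S : pred 'I_n.+1) :
  \int[joint_law (exclude excluded C S)]_w (uP (mask S w))%:E <= objective C.
Proof.
apply: le_trans (C_opt (exclude excluded C S)); rewrite objectiveE.
apply: ae_ge0_le_integral => //.
- by move=> w _; rewrite lee_fin mask_uP_ge0.
- exact: measurable_mask_uP.
- by move=> w _; rewrite lee_fin le_max lexx.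
- by apply/measurable_EFinP; apply: measurable_maxr => //; exact: measurable_uP.
- apply: filterS (ae_exclude C S) => w wS _; rewrite lee_fin le_max.
  by rewrite mask_le_uP ?orbT // => i; have [] := wS i.
Qed.

Lemma expectation_le_objective (k : 'I_n.+1) :
  'E_(law (C k))[fun u : utility_pair R => u.2] <= objective C.
Proof.
apply: le_trans (C_opt (exclude excluded C (pred1 k))).
rewrite expectation_lawE objectiveE.
rewrite (_ : law (C k) = law (exclude excluded C (pred1 k) k)); last first.
  by rewrite /exclude /= eqxx.
rewrite -(integral_product_law_tnth (fun i => law (exclude excluded C (pred1 k) i))); last 2 first.
- by apply/measurable_EFinP; apply: measurable_maxr => //; exact: measurable_snd.
- by move=> u; rewrite lee_fin le_max lexx.
apply: ae_ge0_le_integral => //.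
- by move=> w _; rewrite lee_fin le_max lexx.
- apply/measurable_EFinP; apply: measurable_maxr => //; exact: measurable_tnth2.
- by move=> w _; rewrite lee_fin le_max lexx.
- by apply/measurable_EFinP; apply: measurable_maxr => //; exact: measurable_uP.
- apply: filterS (ae_exclude C (pred1 k)) => w wk _; rewrite lee_fin.
  (* All actions other than [k] give the agent [-oo], so [k] is a maximizer even when it gives [-oo]
     too; tie-breaking then only helps the principal. *)
  rewrite ge_max le_max lexx /= le_max le_uP ?orbT // => j.
  have [->//|jk] := eqVneq j k.
  by have [_ ->] := wk j; rewrite ?leNye.
Qed.

Context (U : \bar R).
Let B := [set u : utility_pair R | u.1 <= U].
Let A := [set w : n.+1.-tuple (utility_pair R) | uA w <= U].

Lemma measurable_uA_le : measurable A.
Proof.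
rewrite /A uA_leE (_ : [set _ | _] =
  [set w | forall i, predT i -> B (tnth w i)]).
  by apply: (@measurable_box _ _ _ predT (fun=> B)) => i; exact: measurable_utility_below.
by apply/seteqP; split => w wU i; [move=> _|]; exact: wU.
Qed.

Lemma joint_law_uA_le : joint_law C A = \prod_(i < n.+1) law (C i) B.
Proof.
rewrite /A uA_leE /joint_law -product_law_box // => i.
exact: measurable_utility_below.
Qed.

(** Dropping the constraints on the actions in [S] enlarges [A]. What remains constrains only the
    complement of [S], while the masked payoff reads only [S], so the two factor by independence. *)
Lemma integral_mask_le (S : pred 'I_n.+1) :
  \int[joint_law C]_(w in A) (uP (mask S w))%:E <=
  (\prod_(i < n.+1 | ~~ S i) law (C i) B) * objective C.
Proof.
have mB (i : 'I_n.+1) : measurable B by exact: measurable_utility_below.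
apply: (@le_trans _ _ (\int[joint_law C]_(w in
    [set w | forall i, ~~ S i -> B (tnth w i)]) (uP (mask S w))%:E)).
  apply: ge0_subset_integral => //.
  - exact: measurable_uA_le.
  - exact: (@measurable_box _ _ _ (fun i => ~~ S i) (fun=> B) mB).
  - by apply: measurable_funTS; exact: measurable_mask_uP.
  - by move=> w _; rewrite lee_fin mask_uP_ge0.
  - by rewrite /A uA_leE => w wU i _; exact: wU.
rewrite /joint_law (integral_product_law_box
  (B := fun=> B) (P' := fun i => law (exclude excluded C S i)) mB) //.
- apply: lee_wpmul2l; last exact: mask_le_objective.
  by apply: prode_ge0 => i _; exact: measure_ge0.
- by move=> i Si; rewrite /exclude Si.
- exact: measurable_mask_uP.
- by move=> w; rewrite lee_fin mask_uP_ge0.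
- by move=> w w' /eq_mask ->.
Qed.

Lemma integral_tnth_le (k : 'I_n.+1) :
  \int[joint_law C]_(w in A) (Num.max 0%R (tnth w k).2)%:E <=
  (\prod_(i < n.+1 | i != k) law (C i) B) * \int[law (C k)]_(u in B) (u.2)%:E.
Proof.
have mB (i : 'I_n.+1) : measurable B by exact: measurable_utility_below.
pose g (u : utility_pair R) := (Num.max 0%R u.2)%:E.
have mg : measurable_fun setT g.
  by apply/measurable_EFinP; apply: measurable_maxr => //; exact: measurable_snd.
have mgB : measurable_fun setT (g \_ B).
  by apply/(measurable_restrict _ (mB k)) => //; exact: measurable_funTS.
have gB0 u : 0 <= (g \_ B) u.
  by rewrite patchE; case: ifP => // _; rewrite lee_fin le_max lexx.
(* Restricting [g] to [B] moves the constraint on coordinate [k] into the integrand, so the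
   factorization applies with [S] reduced to [k] and the constraint survives for local alignment. *)
pose h (w : n.+1.-tuple (utility_pair R)) := (g \_ B) (tnth w k).
have mh : measurable_fun setT h by exact: measurableT_comp mgB (measurable_tnth k).
rewrite (eq_integral h); last first.
  move=> w; rewrite inE /A uA_leE => wU; rewrite /h patchE ifT //.
  by rewrite inE; exact: wU.
apply: (@le_trans _ _ (\int[joint_law C]_(w in
    [set w | forall i, ~~ pred1 k i -> B (tnth w i)]) h w)).
  apply: ge0_subset_integral => //.
  - exact: measurable_uA_le.
  - exact: (@measurable_box _ _ _ (fun i => ~~ pred1 k i) (fun=> B) mB).
  - exact: measurable_funTS.
  - by move=> w _; exact: gB0.
  - by rewrite /A uA_leE => w wU i _; exact: wU.
rewrite /joint_law (integral_product_law_box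
  (B := fun=> B) (P' := fun i => law (C i)) mB) //; last 2 first.
- by move=> w; exact: gB0.
- by move=> w w' /(_ k) ww'; rewrite /h ww' //= eqxx.
rewrite integral_product_law_tnth // -integral_mkcond.
rewrite (@ae_eq_integral _ _ _ _ _ (fun u : utility_pair R => (u.2)%:E) g) //.
- exact: mB k.
- exact: measurable_funTS.
- by apply: measurable_funTS; apply/measurable_EFinP; exact: measurable_snd.
- by apply: filterS (lawP (C k)) => u [_ u0] _; rewrite /g max_r.
Qed.

End exclusion.

(** Take the largest [k] whose preceding product is at least the root of [q]; index 0 qualifies by
    the empty product. If [k] is last, the product after it is empty. Otherwise, by maximality, the
    product up to and including [k] is below the root; times the product after [k] it equals [q], so
    the latter exceeds the root. *)
Lemma balanced_index (R : realType) (n : nat) (p : 'I_n.+1 -> R) :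
  (forall i, 0 < p i) -> (forall i, p i <= 1) ->
  let q := \prod_(i < n.+1) p i in
  exists k : 'I_n.+1,
    Num.sqrt q <= \prod_(i < n.+1 | (i < k)%N) p i /\
    Num.sqrt q <= \prod_(i < n.+1 | (k < i)%N) p i.
Proof.
move=> p0 p1 q.
have q0 : 0 < q by apply: prodr_gt0.
have prod_gt0 (P : pred 'I_n.+1) : 0 < \prod_(i < n.+1 | P i) p i by exact: prodr_gt0.
have q1 : Num.sqrt q <= 1.
  by rewrite -sqrtr1 ler_sqrt //; apply: prodr_ile1 => i _; rewrite ltW ?p0 ?p1.
pose large (k : 'I_n.+1) := Num.sqrt q <= \prod_(i < n.+1 | (i < k)%N) p i.
have large0 : large ord0 by rewrite /large big_pred0.
case: (@arg_maxnP _ ord0 large val large0) => k large_k max_k.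
exists k; split => //.
have [kn|kn] := ltnP k.+1 n.+1; last first.
  by rewrite big_pred0 // => i; rewrite ltnNge -ltnS (leq_trans _ kn).
have : ~~ large (Ordinal kn).
  by apply/negP => /max_k /=; rewrite ltnn.
rewrite /large -ltNge /= => small_k.
have qE : q = (\prod_(i < n.+1 | (i < k.+1)%N) p i) * \prod_(i < n.+1 | (k < i)%N) p i.
  rewrite /q (bigID (fun i : 'I_n.+1 => (i < k.+1)%N)) /=; congr (_ * _).
  by apply: eq_bigl => i; rewrite -leqNgt.
rewrite -(ler_pM2l (_ : 0 < Num.sqrt q)) ?sqrtr_gt0 // -expr2 sqr_sqrtr ?ltW //.
by rewrite [ltLHS]qE ltr_pM2r.
Qed.

(** * From the three group bounds to global alignment *)

Theorem lemma30 (R : realType) (n : nat) (I : instance R n.+1) (f : R -> R)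
    (f_ge0 : forall q, 0 < q -> q <= 1 -> 0 <= f q)
    (f_noninc : nonincreasing01 f)
    (I_excl : excludable I)
    (I_loc : locally_utility_aligned I f) :
  utility_aligned I (fun q => Num.max (4 * f q) (4 / Num.sqrt q)).
Proof.
split=> [x y x0 xy y1|C U C_opt U_oo P A q q0].
  have y0 := lt_le_trans x0 xy.
  have sqrt_le : 4 / Num.sqrt y <= 4 / Num.sqrt x.
    by rewrite ler_pM2l // lef_pV2 ?posrE ?sqrtr_gt0 // ler_wsqrtr.
  by rewrite ge_max !le_max sqrt_le ler_pM2l // f_noninc ?orbT.
set g := Num.max _ _.
have g0 : 0 < g by rewrite lt_max [X in _ || X]divr_gt0 ?sqrtr_gt0 ?orbT.
have O0 := objective_ge0 C.
(* With an infinite optimum the right-hand side is [+oo], because [g] is positive. *)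
have [->|Ofin] := eqVneq (objective C) +oo%E.
  by rewrite mulry gtr0_sg // mul1e leey.
pose B := [set u : utility_pair R | (u.1 <= U)%E]%classic.
pose p i := fine (law (C i) B).
have lawB i : law (C i) B = (p i)%:E by rewrite fineK // fin_num_measure //; exact: measurable_utility_below.
have qE : q = \prod_(i < n.+1) p i.
  by rewrite /q /P /A joint_law_uA_le (eq_bigr _ (fun i _ => lawB i)) prodEFin.
have p0 i : 0 < p i.
  rewrite lt_neqAle fine_ge0 ?measure_ge0 // andbT eq_sym; apply/eqP => pi0.
  by move: q0; rewrite qE (bigD1 i) //= pi0 mul0r ltxx.
have p1 i : p i <= 1.
  by rewrite -lee_fin -lawB; apply: probability_le1; exact: measurable_utility_below.
have prod_gt0 (S : pred 'I_n.+1) : 0 < \prod_(i < n.+1 | S i) p i by exact: prodr_gt0.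
have q1 : q <= 1 by rewrite qE; apply: prodr_ile1 => i _; rewrite ltW ?p0 ?p1.
have [opt oE] : exists v, objective C = v%:E.
  by exists (fine (objective C)); rewrite fineK // ge0_fin_numE // ltey.
have o0 : 0 <= opt by rewrite -lee_fin -oE.
have [k [k_lt k_gt]] := balanced_index p0 p1; rewrite -qE in k_lt k_gt.
(* The product over the complement of [S] is [q] divided by the product over [S], hence at most
   [q / Num.sqrt q]. *)
have mask_bound (S : pred 'I_n.+1) : Num.sqrt q <= \prod_(i < n.+1 | S i) p i ->
    (\int[P]_(w in A) (uP (mask S w))%:E <= (q / Num.sqrt q * opt)%:E)%E.
  move=> qS; apply: le_trans (integral_mask_le I_excl C_opt U S) _.
  rewrite (eq_bigr _ (fun i _ => lawB i)) prodEFin oE -EFinM lee_fin.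
  apply: ler_wpM2r => //; rewrite ler_pdivlMr ?sqrtr_gt0 //.
  rewrite [leRHS]qE [leRHS](bigID S) /= [leRHS]mulrC; apply: ler_wpM2l => //.
  exact/ltW/prod_gt0.
have k_bound :
    (\int[P]_(w in A) (Num.max 0 (tnth w k).2)%:E <= (q * f q * opt)%:E)%E.
  apply: le_trans (integral_tnth_le C U k) _.
  rewrite (eq_bigr _ (fun i _ => lawB i)) prodEFin.
  have := I_loc.2 k (C k) U U_oo (p0 k).
  rewrite /cond_expectation -/B -/(p k) => loc.
  have {}loc : (\int[law (C k)]_(u in B) (u.2)%:E <= (p k * f q * opt)%:E)%E.
    rewrite lee_pdivrMr // in loc; apply: le_trans loc _.
    rewrite muleC EFinM [in leRHS]EFinM muleA -oE.
    apply: lee_pmul; rewrite ?mule_ge0 ?lee_fin ?f_ge0 ?(ltW (p0 k)) //.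
    - by rewrite expectation_lawE integral_ge0 // => u _; rewrite lee_fin le_max lexx.
    (* Local alignment yields [f (p k)]. Since the other factors are at most 1, [q <= p k], and so
       [f (p k) <= f q]. *)
    - rewrite ler_pM2l // f_noninc // qE (bigD1 k) //= ler_piMr ?(ltW (p0 k)) //.
      by apply: prodr_ile1 => i _; rewrite ltW ?p0 ?p1.
    - exact: expectation_le_objective.
  apply: le_trans (lee_wpmul2l _ loc) _; first by rewrite lee_fin ltW.
  have -> : q = \prod_(i < n.+1 | i != k) p i * p k by rewrite qE (bigD1 k) //= mulrC.
  by rewrite -EFinM lee_fin !mulrA.
have mA : measurable A by exact: measurable_uA_le.
pose F w := (Num.max 0 (@uP R n w))%:E.
pose F1 (w : n.+1.-tuple (utility_pair R)) := (uP (mask (fun i : 'I_n.+1 => (i < k)%N) w))%:E.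
pose F2 (w : n.+1.-tuple (utility_pair R)) := (Num.max 0 (tnth w k).2)%:E.
pose F3 (w : n.+1.-tuple (utility_pair R)) := (uP (mask (fun i : 'I_n.+1 => (k < i)%N) w))%:E.
have mF1 : measurable_fun A F1 by apply: measurable_funTS; exact: measurable_mask_uP.
have mF3 : measurable_fun A F3 by apply: measurable_funTS; exact: measurable_mask_uP.
have mF2 : measurable_fun A F2.
  by apply/measurable_EFinP/measurable_maxr => //; apply: measurable_funTS; exact: measurable_tnth2.
have mu : measurable_fun A (@uP R n) by apply: measurable_funTS; exact: measurable_uP.
have F10 w : (0 <= F1 w)%E by rewrite lee_fin mask_uP_ge0.
have F20 w : (0 <= F2 w)%E by rewrite lee_fin le_max lexx.
have F30 w : (0 <= F3 w)%E by rewrite lee_fin mask_uP_ge0.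
have uPE : (\int[P]_(w in A) (uP w)%:E = \int[P]_(w in A) F w)%E.
  apply: ae_eq_integral => //.
  - exact/measurable_EFinP.
  - by apply/measurable_EFinP/measurable_maxr.
  - have := ae_product_law (fun i => lawP (C i)).
    apply: filterS => w w0 _; congr (_%:E).
    by rewrite max_r //; have [] := w0 (chosen w).
(* The chosen action lies in one of the three groups; that group's term alone dominates [F w], and
   the other two are nonnegative. *)
have F_le w : (F w <= F1 w + F2 w + F3 w)%E.
  have [ck|ck|ck] := ltngtP (chosen w) k.
  - apply: (@le_trans _ _ (F1 w)); last by rewrite -addeA leeDl // adde_ge0.
    by rewrite lee_fin ge_max mask_uP_ge0 uP_le_mask.
  - apply: (@le_trans _ _ (F3 w)); last by rewrite leeDr // adde_ge0.
    by rewrite lee_fin ge_max mask_uP_ge0 uP_le_mask.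
  - apply: (@le_trans _ _ (F2 w)); last by rewrite -addeA addeCA leeDl // adde_ge0.
    by rewrite /F /F2 /uP (val_inj ck).
rewrite /cond_expectation -/q lee_pdivrMr // oE uPE.
apply: (@le_trans _ _ (\int[P]_(w in A) (F1 w + F2 w + F3 w))%E).
  apply: ge0_le_integral => //.
  - by move=> w _; rewrite lee_fin le_max lexx.
  - by apply/measurable_EFinP/measurable_maxr.
  - by apply: emeasurable_funD => //; apply: emeasurable_funD.
rewrite ge0_integralD //; last 2 first.
- by move=> w _; apply: adde_ge0.
- by apply: emeasurable_funD.
rewrite ge0_integralD //.
apply: le_trans (leeD (leeD (mask_bound _ k_lt) k_bound) (mask_bound _ k_gt)) _.
rewrite -!EFinD -!EFinM lee_fin.
have g1 : 4 * f q <= g by rewrite le_max lexx.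
have g2 : 4 / Num.sqrt q <= g by rewrite le_max lexx orbT.
set s := (Num.sqrt q)^-1 in g2 *.
have -> : q * s * opt + q * f q * opt + q * s * opt = (2 * s + f q) * opt * q by ring.
apply: ler_wpM2r; first exact: ltW.
(* From [g1] and [g2], [2 * s + f q] is at most [g / 2 + g / 4], which is below [g] since [g] is
   positive. *)
apply: ler_wpM2r => //; lra.
Qed.
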